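(* Let $\{G_n\}_{n\ge0}$ be a Gibonacci sequence. For all positive integers $n$ and all positive integers $p\leq n$, $$G_n^2=G_{n+p}G_{n-p}+(-1)^{n+p-1}f_{p-1}\,(G_0G_{p+1}-G_1G_p).$$
   Context: A Gibonacci sequence is a sequence satisfying $G_n=G_{n-1}+G_{n-2}$ for $n\ge2$, with initial values $G_0,G_1$ chosen freely (here arbitrary integers). The numbers $f_n$ are the shifted Fibonacci numbers $f_n=F_{n+1}$, where $F_0=0$, $F_1=1$, $F_n=F_{n-1}+F_{n-2}$ (so $f_0=f_1=1$, $f_2=2$). *)

(* Defs.v *)
From mathcomp Require Import all_boot all_order all_algebra.

Set Implicit Arguments.
Unset Strict Implicit.
Unset Printing Implicit Defensive.

Import GRing.Theory.
Local Open Scope ring_scope.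

Definition gibonacci (G : nat -> int) : Prop :=
  forall n : nat, (2 <= n)%N -> G n = G (n - 1)%N + G (n - 2)%N.

Fixpoint fib (n : nat) : nat :=
  match n with
  | 0 => 0
  | 1 => 1
  | (m.+1 as k).+1 => fib k + fib m
  end%N.

Definition shifted_fib (n : nat) : nat := fib n.+1.

(* Main.v *)
Require Import Defs.
From mathcomp Require Import all_boot all_order all_algebra.
From mathcomp Require Import ring zify.

(** Put [m = n - p].  Since two consecutive terms determine a Gibonacci sequence
    linearly, [G (k + p) = F_p * G (k + 1) + F_(p-1) * G k] for every [k]
    ([gibonacci_add]).  Expand one factor of [G (m + p) ^ 2] by this rule at
    [k = m], and the factor [G (m + 2p)] of [G (m + 2p) * G m] by the same rule
    at [k = m + p].  The [F_(p-1)] terms cancel, and the difference becomes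
    [- F_p] times the 2x2 determinant
    [G m * G (m + p + 1) - G (m + 1) * G (m + p)].  One step of the recurrence
    negates such a determinant ([gibonacci_det]), so it equals [(-1) ^ m] times
    its value at [m = 0], which is the last factor of the statement. *)

Import GRing.Theory.
Local Open Scope ring_scope.

Lemma gibonacciSS (G : nat -> int) (hG : gibonacci G) (n : nat) :
  G n.+2 = G n.+1 + G n.
Proof. by rewrite hG // subn1 subn2. Qed.

Lemma fibSS (n : nat) : fib n.+2 = (fib n.+1 + fib n)%N.
Proof. by []. Qed.

(** Both sides are Gibonacci in [q], so agreement at [q = 0] and [q = 1] is
    enough; the induction carries two consecutive instances. *)
Lemma gibonacci_add (G : nat -> int) (hG : gibonacci G) (k q : nat) :
  G (k + q.+1)%N = (fib q.+1)%:Z * G k.+1 + (fib q)%:Z * G k.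
Proof.
suff [] : G (k + q.+1)%N = (fib q.+1)%:Z * G k.+1 + (fib q)%:Z * G k /\
          G (k + q.+2)%N = (fib q.+2)%:Z * G k.+1 + (fib q.+1)%:Z * G k by [].
elim: q => [|q [IH1 IH2]].
  by rewrite addn1 addn2 gibonacciSS //= !mul1r mul0r addr0.
split=> //; rewrite addnS addnS gibonacciSS // -!addnS IH1 IH2.
by rewrite (fibSS q.+1) (fibSS q) !PoszD; ring.
Qed.

(** The matrix with rows [(G m, G (m + 1))] and [(G (m + p), G (m + p + 1))] is
    multiplied, when [m] grows by one, by the matrix of the recurrence, whose
    determinant is [-1]. *)
Lemma gibonacci_det (G : nat -> int) (hG : gibonacci G) (p m : nat) :
  G m * G (m + p).+1 - G m.+1 * G (m + p)%N
    = (-1) ^+ m * (G 0%N * G p.+1 - G 1%N * G p).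
Proof.
elim: m => [|m IH]; first by rewrite expr0 mul1r add0n.
by rewrite exprS -mulrA -IH addSn !(gibonacciSS _ hG); ring.
Qed.

Theorem theorem4p8 (G : nat -> int) (hG : gibonacci G) (n p : nat)
    (hn : (0 < n)%N) (hp : (0 < p)%N) (hpn : (p <= n)%N) :
  G n ^+ 2 = G (n + p)%N * G (n - p)%N
    + (-1) ^+ (n + p - 1)%N * (shifted_fib (p - 1)%N)%:Z
      * (G 0%N * G (p + 1)%N - G 1%N * G p).
Proof.
case: p hp hpn => // q _ hpn.
(* The occurrence of [n] left alone is the one in [n - p], which becomes [m]. *)
rewrite -{1 2 4}(subnK hpn); move: (n - q.+1)%N => m.
have sgn : (-1) ^+ (m + q.+1 + q.+1 - 1) = - (-1) ^+ m :> int.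
  have -> : (m + q.+1 + q.+1 - 1 = (m + q.*2).+1)%N by lia.
  by rewrite exprS exprD -mul2n exprM sqrrN !expr1n; ring.
have det := gibonacci_det G hG q.+1 m.
have add1 := gibonacci_add G hG m q.
have add2 := gibonacci_add G hG (m + q.+1) q.
rewrite sgn subn1 /shifted_fib [q.+1.-1]/= addn1 mulNr mulNr mulrAC -det add2.
by rewrite expr2 {1}add1; ring.
Qed.
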